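(* Let $m,n\in\mathbb{N}$ with $1\le m\le n$, let $f\colon\mathbb{R}^2\to\mathbb{R}$ be $n$-times continuously differentiable, let $B_0\subset\mathbb{R}^2$ be a box, and for $j=0,\dots,n$ let $\Box f^{(n-j,j)}$ be a range function for $f^{(n-j,j)}$ that is bounded over $B_0$. Then the Taylor form $\Box^{\mathrm{T}}_{m,n}f$ of order $m$ and level $n$ (defined in the context) has order $m$ convergence on $B_0$; that is, there exists a constant $C>0$, which may depend on $f$ and $B_0$ (as well as on $m$, $n$ and the given range functions) but not on $B$, such that $$d_{\mathrm{H}}\bigl(f(B),\,\Box^{\mathrm{T}}_{m,n}f(B)\bigr)\le C\,w(B)^m$$ for all squares $B\subseteq B_0$.
   Context: A box is a closed axis-aligned rectangle $B=[a_x,b_x]\times[a_y,b_y]\subset\mathbb{R}^2$; its midpoint is $\boldsymbol m=(m_x,m_y)=(a_x+b_x,a_y+b_y)/2$, its radii are $(r_x,r_y)=(b_x-a_x,b_y-a_y)/2$, and its width is $w(B)=2\max(r_x,r_y)$. A square is a box with $r_x=r_y$, and this common value is called its radius $r$. For a closed interval $I=[a,b]$, its magnitude is $|I|=\max\{|a|,|b|\}$. Intervals are added and scaled by interval arithmetic: $[a,b]+[c,d]=[a+c,b+d]$, and $\rho[-1,1]=[-\rho,\rho]$ for $\rho\ge 0$. The Hausdorff distance is $d_{\mathrm{H}}([a,b],[a',b'])=\max\{|a-a'|,|b-b'|\}$. For a function $g$ and a set $S$, $g(S)=\{g(x):x\in S\}$ is the exact range. A range function for $g\colon\mathbb{R}^2\to\mathbb{R}$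 is a map $\Box g$ from boxes to closed bounded intervals with $\Box g(B)\supseteq g(B)$ for every box $B$. It is bounded over $B_0$ if there is a constant $K$ with $|\Box g(B)|\le K$ for all boxes $B\subseteq B_0$. Partial derivatives are denoted by $f^{(i,j)}=\frac{\partial^{i+j}}{\partial x^i\partial y^j}f$. For a square $B$ with midpoint $\boldsymbol m$ and radius $r$, let $$T_{m-1}(x,y)=\sum_{k=0}^{m-1}\frac1{k!}\sum_{j=0}^k\binom kj (x-m_x)^{k-j}(y-m_y)^j f^{(k-j,j)}(\boldsymbol m)$$ be the Taylor polynomial of $f$ of degree $m-1$ about $\boldsymbol m$. The Taylor form of order $m$ and level $n$ is $$\Box^{\mathrm{T}}_{m,n}f(B)=T_{m-1}(B)+r^m[-1,1]\,S_{m,n},\qquad S_{m,n}=\sum_{k=m}^n s_k r^{k-m},$$ where $$s_k=\frac1{k!}\sum_{j=0}^k\binom kj\bigl|f^{(k-j,j)}(\boldsymbol m)\bigr|\quad(k=m,\dots,n-1),\qquad s_n=\frac1{n!}\sum_{j=0}^n\binom nj\bigl|\Box f^{(n-j,j)}(B)\bigr|.$$ *)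

(* Defs.v *)
From Stdlib Require Import Reals Lra Lia Arith.
From Coquelicot Require Import Coquelicot.
Open Scope R_scope.

(* Degenerate boxes (points, segments) are allowed. *)
Record box := Box {
  bax : R; bbx : R; bay : R; bby : R;
  bx_le : bax <= bbx;
  by_le : bay <= bby }.

Definition in_box (B : box) (x y : R) : Prop :=
  bax B <= x <= bbx B /\ bay B <= y <= bby B.

Definition subbox (B B' : box) : Prop :=
  forall x y : R, in_box B x y -> in_box B' x y.

Definition midx (B : box) : R := (bax B + bbx B) / 2.
Definition midy (B : box) : R := (bay B + bby B) / 2.
Definition radx (B : box) : R := (bbx B - bax B) / 2.
Definition rady (B : box) : R := (bby B - bay B) / 2.
Definition width (B : box) : R := 2 * Rmax (radx B) (rady B).

Record square := Square {
  sq_box :> box;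
  sq_rad : radx sq_box = rady sq_box }.

Definition rad (B : square) : R := radx B.

(* A pair of endpoints.  The condition [lo <= hi] is not part of the type; it
   follows wherever the interval encloses the range of a function on a box,
   boxes being nonempty. *)
Record itv := Itv { lo : R; hi : R }.

Definition in_itv (I : itv) (z : R) : Prop := lo I <= z <= hi I.
Definition mag (I : itv) : R := Rmax (Rabs (lo I)) (Rabs (hi I)).
Definition iadd (I J : itv) : itv := Itv (lo I + lo J) (hi I + hi J).
(* rho [-1, 1], used for rho >= 0 only. *)
Definition ball0 (rho : R) : itv := Itv (- rho) rho.
Definition dH (I J : itv) : R :=
  Rmax (Rabs (lo I - lo J)) (Rabs (hi I - hi J)).

Definition image (g : R -> R -> R) (B : box) (z : R) : Prop :=
  exists x y : R, in_box B x y /\ g x y = z.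

(* The exact range g(B) as an interval: for continuous g, the interval
   [inf g(B), sup g(B)] is equal to the set g(B) (lemma [range_exact]). *)
Definition range (g : R -> R -> R) (B : box) : itv :=
  Itv (real (Glb_Rbar (image g B))) (real (Lub_Rbar (image g B))).

Definition range_function (g : R -> R -> R) (bg : box -> itv) : Prop :=
  forall (B : box) (z : R), image g B z -> in_itv (bg B) z.

Definition bounded_over (bg : box -> itv) (B0 : box) : Prop :=
  exists K : R, forall B : box, subbox B B0 -> mag (bg B) <= K.

(* [ex_diff_n f n x y] demands that f and all its iterated partial derivatives,
   in any order of differentiation and up to total order n, exist and are
   continuous at (x, y). *)
Definition class_Cn (n : nat) (f : R -> R -> R) : Prop :=
  forall x y : R, ex_diff_n f n x y.

(* [partial_derive i j f] is f^(i,j): i times in x and j times in y.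
   [Binomial.C] is the real-valued binomial coefficient. *)
Definition taylor_poly (deg : nat) (f : R -> R -> R) (mx my x y : R) : R :=
  sum_f_R0 (fun k =>
    / INR (fact k) *
    sum_f_R0 (fun j =>
      Binomial.C k j * (x - mx) ^ (k - j) * (y - my) ^ j *
      partial_derive (k - j) j f mx my) k) deg.

(* [bf j] stands for the range function of f^(n-j,j). *)
Definition taylor_s (n : nat) (f : R -> R -> R) (bf : nat -> box -> itv)
    (B : square) (k : nat) : R :=
  / INR (fact k) *
  sum_f_R0 (fun j =>
    Binomial.C k j *
    (if (k <? n)%nat
     then Rabs (partial_derive (k - j) j f (midx B) (midy B))
     else mag (bf j B))) k.

Definition taylor_S (m n : nat) (f : R -> R -> R) (bf : nat -> box -> itv)
    (B : square) : R :=
  sum_n_m (fun k => taylor_s n f bf B k * rad B ^ (k - m)) m n.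

(* Taylor form of order m and level n, for 1 <= m <= n. *)
Definition taylor_form (m n : nat) (f : R -> R -> R) (bf : nat -> box -> itv)
    (B : square) : itv :=
  iadd (range (taylor_poly (m - 1) f (midx B) (midy B)) B)
       (ball0 (rad B ^ m * taylor_S m n f bf B)).

Definition convergence_of_order (m : nat) (f : R -> R -> R)
    (F : square -> itv) (B0 : box) : Prop :=
  exists C : R, 0 < C /\
    forall B : square, subbox B B0 -> dH (range f B) (F B) <= C * width B ^ m.

Lemma continuous_bounded (g : R -> R -> R) (B : box) :
  (forall x y, continuity_2d_pt g x y) ->
  exists K : R, forall x y, in_box B x y -> g x y <= K.
Proof.
intros Hc.
destruct (uniform_continuity_2d g (bax B) (bbx B) (bay B) (bby B)
            (fun x y _ _ => Hc x y) (mkposreal 1 Rlt_0_1)) as [d Hd].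
simpl in Hd. pose proof (cond_pos d) as Hdp.
set (L := (bbx B - bax B) + (bby B - bay B)).
pose proof (bx_le B) as Hx. pose proof (by_le B) as Hy.
destruct (INR_unbounded (L / d)) as [N HN].
exists (g (bax B) (bay B) + INR (S N)).
intros x y [Bx By].
assert (HSN : 0 < INR (S N)) by (apply lt_0_INR; lia).
assert (HL : L < d * INR (S N)).
{ rewrite S_INR. apply Rmult_lt_compat_r with (r := d) in HN; [|lra].
  unfold Rdiv in HN. rewrite Rmult_assoc, Rinv_l in HN; lra. }
set (u := (x - bax B) / INR (S N)). set (v := (y - bay B) / INR (S N)).
assert (Eu : u * INR (S N) = x - bax B) by (unfold u; field; lra).
assert (Ev : v * INR (S N) = y - bay B) by (unfold v; field; lra).
assert (Hu0 : 0 <= u) by (apply Rmult_le_reg_r with (INR (S N)); lra).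
assert (Hv0 : 0 <= v) by (apply Rmult_le_reg_r with (INR (S N)); lra).
assert (Hud : u < d)
  by (apply Rmult_lt_reg_r with (INR (S N)); unfold L in HL; lra).
assert (Hvd : v < d)
  by (apply Rmult_lt_reg_r with (INR (S N)); unfold L in HL; lra).
assert (HI : forall i, (i <= S N)%nat ->
          g (bax B + INR i * u) (bay B + INR i * v)
          <= g (bax B) (bay B) + INR i).
{ induction i as [|i IH]; intros Hi.
  - simpl. rewrite !Rmult_0_l, !Rplus_0_r. lra.
  - specialize (IH ltac:(lia)).
    assert (H1 : INR (S i) <= INR (S N)) by (apply le_INR; lia).
    assert (H0 : 0 <= INR i) by apply pos_INR.
    rewrite (S_INR i) in *.
    assert (H2 := Hd (bax B + INR i * u) (bay B + INR i * v)
                     (bax B + (INR i + 1) * u) (bay B + (INR i + 1) * v)).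
    assert (Rabs (g (bax B + (INR i + 1) * u) (bay B + (INR i + 1) * v)
              - g (bax B + INR i * u) (bay B + INR i * v)) < 1) as H3.
    { apply H2; try (split; nra).
      - replace (_ - _) with u by ring. rewrite Rabs_pos_eq; lra.
      - replace (_ - _) with v by ring. rewrite Rabs_pos_eq; lra. }
    apply Rabs_def2 in H3. lra. }
specialize (HI (S N) (le_n _)).
rewrite (Rmult_comm _ u), (Rmult_comm _ v), Eu, Ev in HI.
replace (bax B + (x - bax B)) with x in HI by ring.
replace (bay B + (y - bay B)) with y in HI by ring.
exact HI.
Qed.

Lemma continuous_max (g : R -> R -> R) (B : box) :
  (forall x y, continuity_2d_pt g x y) ->
  exists x0 y0, in_box B x0 y0 /\
    forall x y, in_box B x y -> g x y <= g x0 y0.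
Proof.
intros Hc.
destruct (continuous_bounded g B Hc) as [K HK].
destruct (completeness (image g B)) as [M [HM1 HM2]].
- exists K. intros z [x [y [H <-]]]. auto.
- exists (g (bax B) (bay B)), (bax B), (bay B).
  pose proof (bx_le B). pose proof (by_le B). repeat split; lra.
- destruct (Classical_Prop.classic (exists x y, in_box B x y /\ g x y = M))
    as [[x [y [H E]]]|Hn].
  + exists x, y. split; [exact H|]. intros u v Huv. rewrite E. apply HM1.
    exists u, v. auto.
  + exfalso.
    assert (Hlt : forall x y, in_box B x y -> g x y < M).
    { intros x y H. destruct (HM1 (g x y)) as [|E].
      - exists x, y; auto.
      - assumption.
      - exfalso; apply Hn; exists x, y; auto. }
    (* Clamping to B makes M - g everywhere positive. *)
    set (cx := fun x => Rmax (bax B) (Rmin (bbx B) x)).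
    set (cy := fun y => Rmax (bay B) (Rmin (bby B) y)).
    pose proof (bx_le B) as Lx. pose proof (by_le B) as Ly.
    assert (Hin : forall x y, in_box B (cx x) (cy y)).
    { intros x y. unfold in_box, cx, cy, Rmax, Rmin.
      repeat destruct Rle_dec; repeat split; lra. }
    assert (Hid : forall x y, in_box B x y -> cx x = x /\ cy y = y).
    { intros x y [H1 H2]. unfold cx, cy, Rmax, Rmin.
      repeat destruct Rle_dec; split; lra. }
    assert (Hlip : forall a b x u, a <= b ->
      Rabs (Rmax a (Rmin b u) - Rmax a (Rmin b x)) <= Rabs (u - x)).
    { intros a b x u Hab. unfold Rmax, Rmin, Rabs.
      repeat destruct Rle_dec; repeat destruct Rcase_abs; lra. }
    set (h := fun x y => M - g (cx x) (cy y)).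
    assert (Hch : forall x y, continuity_2d_pt h x y).
    { intros x y eps. destruct (Hc (cx x) (cy y) eps) as [d Hd].
      exists d. intros u v Hu Hv. unfold h.
      replace (_ - _ - _) with (- (g (cx u) (cy v) - g (cx x) (cy y))) by ring.
      rewrite Rabs_Ropp. apply Hd.
      - eapply Rle_lt_trans; [apply Hlip; exact Lx|exact Hu].
      - eapply Rle_lt_trans; [apply Hlip; exact Ly|exact Hv]. }
    assert (Hpos : forall x y, 0 < h x y).
    { intros x y. unfold h. specialize (Hlt _ _ (Hin x y)). lra. }
    destruct (continuous_bounded (fun x y => / h x y) B) as [Q HQ].
    { intros x y. apply continuity_2d_pt_inv; [apply Hch|].
      specialize (Hpos x y). lra. }
    assert (Q0 : 0 < Q).
    { eapply Rlt_le_trans; [|apply (HQ _ _ (Hin 0 0))].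
      apply Rinv_0_lt_compat, Hpos. }
    assert (M <= M - / Q).
    { apply HM2. intros z [x [y [H <-]]].
      specialize (HQ x y H). specialize (Hpos x y).
      assert (/ Q <= h x y).
      { rewrite <- (Rinv_inv (h x y)). apply Rinv_le_contravar; [|exact HQ].
        now apply Rinv_0_lt_compat. }
      unfold h in H0. destruct (Hid x y H) as [E1 E2]. rewrite E1, E2 in H0.
      lra. }
    pose proof (Rinv_0_lt_compat Q Q0). lra.
Qed.

Lemma range_exact (g : R -> R -> R) (B : box) :
  (forall x y, continuity_2d_pt g x y) ->
  forall z, in_itv (range g B) z <-> image g B z.
Proof.
intros Hc.
destruct (continuous_max g B Hc) as [x1 [y1 [H1 M1]]].
destruct (continuous_max (fun x y => - g x y) B) as [x0 [y0 [H0 M0]]].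
{ intros x y. apply continuity_2d_pt_opp, Hc. }
assert (EL : Lub_Rbar (image g B) = Finite (g x1 y1)).
{ apply is_lub_Rbar_unique. split.
  - intros z [x [y [H <-]]]. simpl. auto.
  - intros b Hb. apply Hb. exists x1, y1; auto. }
assert (EG : Glb_Rbar (image g B) = Finite (g x0 y0)).
{ apply is_glb_Rbar_unique. split.
  - intros z [x [y [H <-]]]. simpl. specialize (M0 x y H). lra.
  - intros b Hb. apply Hb. exists x0, y0; auto. }
intros z. unfold in_itv, range. simpl. rewrite EL, EG. simpl. split.
- intros Hz.
  set (p := fun t : R => g (x0 + t * (x1 - x0)) (y0 + t * (y1 - y0))).
  assert (Hp : continuity p).
  { intros t. unfold p. apply continuity_pt_filterlim.
    apply (continuous_comp_2 (fun t => x0 + t * (x1 - x0))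
             (fun t => y0 + t * (y1 - y0)) g).
    - apply (ex_derive_continuous (fun t => x0 + t * (x1 - x0))).
      auto_derive; trivial.
    - apply (ex_derive_continuous (fun t => y0 + t * (y1 - y0))).
      auto_derive; trivial.
    - apply (proj1 (continuity_2d_pt_filterlim g _ _) (Hc _ _)). }
  destruct (IVT_gen p 0 1 z Hp) as [t [Ht Et]].
  { unfold p. rewrite !Rmult_0_l, !Rmult_1_l, !Rplus_0_r.
    replace (x0 + (x1 - x0)) with x1 by ring.
    replace (y0 + (y1 - y0)) with y1 by ring.
    unfold Rmin, Rmax. repeat destruct Rle_dec; lra. }
  rewrite Rmin_left, Rmax_right in Ht by lra.
  exists (x0 + t * (x1 - x0)), (y0 + t * (y1 - y0)). split; [|exact Et].
  destruct H0, H1. unfold in_box. repeat split; nra.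
- intros [x [y [H <-]]]. specialize (M0 x y H). specialize (M1 x y H). lra.
Qed.

Lemma continuity_2d_sum (F : nat -> R -> R -> R) (n : nat) (x y : R) :
  (forall k, continuity_2d_pt (F k) x y) ->
  continuity_2d_pt (fun u v => sum_f_R0 (fun k => F k u v) n) x y.
Proof.
intros H. induction n as [|n IH]; simpl; [apply H|].
now apply (continuity_2d_pt_plus (fun u v => sum_f_R0 (fun k => F k u v) n)).
Qed.

(* Hence [range_exact] applies to the Taylor polynomial as well as to f. *)
Lemma taylor_poly_continuous (m : nat) (f : R -> R -> R) (mx my x y : R) :
  continuity_2d_pt (taylor_poly m f mx my) x y.
Proof.
assert (P : forall (g : R -> R -> R) k, continuity_2d_pt g x y ->
              continuity_2d_pt (fun u v => g u v ^ k) x y).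
{ intros g k Hg. induction k as [|k IH]; simpl.
  - apply continuity_2d_pt_const.
  - now apply continuity_2d_pt_mult. }
unfold taylor_poly.
apply (continuity_2d_sum (fun k u v => / INR (fact k) *
  sum_f_R0 (fun j => Binomial.C k j * (u - mx) ^ (k - j) * (v - my) ^ j *
    partial_derive (k - j) j f mx my) k)); intros k.
apply (continuity_2d_pt_mult (fun _ _ => / INR (fact k)));
  [apply continuity_2d_pt_const|].
apply (continuity_2d_sum (fun j u v =>
  Binomial.C k j * (u - mx) ^ (k - j) * (v - my) ^ j *
  partial_derive (k - j) j f mx my)); intros j.
apply (continuity_2d_pt_mult
  (fun u v => Binomial.C k j * (u - mx) ^ (k - j) * (v - my) ^ j)
  (fun _ _ => partial_derive (k - j) j f mx my));
  [|apply continuity_2d_pt_const].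
apply (continuity_2d_pt_mult
  (fun u v => Binomial.C k j * (u - mx) ^ (k - j)) (fun u v => (v - my) ^ j)).
- apply (continuity_2d_pt_mult (fun _ _ => Binomial.C k j)
    (fun u v => (u - mx) ^ (k - j))); [apply continuity_2d_pt_const|].
  apply (P (fun u v => u - mx)). apply continuity_2d_pt_minus.
  + apply continuity_2d_pt_id1.
  + apply continuity_2d_pt_const.
- apply (P (fun u v => v - my)). apply continuity_2d_pt_minus.
  + apply continuity_2d_pt_id2.
  + apply continuity_2d_pt_const.
Qed.

(* Main.v *)
Require Import Defs.
From Stdlib Require Import Reals Lra Lia Arith.
From Coquelicot Require Import Coquelicot.
Open Scope R_scope.

(** Write [r] for the radius of [B], [T] for the Taylor polynomial of degree
    [m - 1] about its midpoint and [S] for [taylor_S m n f bf B].  The Taylor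
    form is the exact range of [T] enlarged by [r ^ m * S] on either side, so
    [dH_iadd_ball0] bounds the distance sought by
    [dH (f(B)) (T(B)) + |r ^ m * S|], and it suffices that both terms are
    [O(r ^ m)], uniformly in [B].

    For the second term this says that [S] is bounded ([taylor_S_ubounded]).
    Its entries of index below [n] are built from partial derivatives of [f]
    at a point of [B0], which are continuous and hence bounded on that compact
    box; the entry of index [n] is bounded by the assumption on the range
    functions; the powers of [r] are bounded because [B] lies inside [B0].

    For the first term, two continuous functions at uniform distance at most
    [e] on a box have ranges at Hausdorff distance at most [e]
    ([dH_range_le]), so a uniform bound [|f - T| <= K * r ^ m] is enough
    ([taylor_remainder_bound]).  It is the Lagrange form of the remainder for
    the restriction of [f] to the segment from the midpoint to a point of [B]
    ([taylor_lagrange_line]).  The [k]-th derivative of that restriction is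
    the binomial combination [dir_derive] of the partial derivatives of order
    [k] ([Derive_n_line]), by induction on [k] from the chain rule and
    Pascal's rule; both coordinates of the direction of the segment have
    absolute value at most [r], which gives the factor [r ^ m] of the
    remainder. *)

(** * Derivatives along a line *)

(** The binomial step of the induction behind [dir_derive]: differentiating
    the [j]-th term of order [k] along a line yields the terms [G j] and
    [G (S j)] of order [S k], and Pascal's rule collects them. *)
Lemma pascal_sum (k : nat) (G : nat -> R) :
  sum_f_R0 (fun j => Binomial.C (S k) j * G j) (S k) =
  sum_f_R0 (fun j => Binomial.C k j * (G j + G (S j))) k.
Proof.
assert (C0 : forall p, Binomial.C p 0 = 1).
{ intros p. unfold Binomial.C. rewrite Nat.sub_0_r. simpl (INR (fact 0)).
  field. apply INR_fact_neq_0. }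
assert (Cn : forall p, Binomial.C p p = 1).
{ intros p. unfold Binomial.C. rewrite Nat.sub_diag. simpl (INR (fact 0)).
  field. apply INR_fact_neq_0. }
transitivity (sum_f_R0 (fun j => Binomial.C k j * G j) k +
              sum_f_R0 (fun j => Binomial.C k j * G (S j)) k).
- rewrite decomp_sum by lia. rewrite Nat.pred_succ.
  destruct k as [|p].
  + simpl. rewrite !C0, Cn. ring.
  + rewrite tech5, Cn, C0.
    rewrite (decomp_sum (fun j => Binomial.C (S p) j * G j)) by lia.
    rewrite Nat.pred_succ, C0.
    rewrite (tech5 (fun j => Binomial.C (S p) j * G (S j))), Cn.
    rewrite (sum_eq _ (fun j => Binomial.C (S p) (S j) * G (S j) +
                                Binomial.C (S p) j * G (S j))).
    * rewrite sum_plus. ring.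
    * intros i Hi. rewrite <- (pascal (S p) i) by lia. ring.
- rewrite <- sum_plus. apply sum_eq. intros i _. ring.
Qed.

Lemma partial_derive_continuous (n : nat) (f : R -> R -> R) (i j : nat)
    (x y : R) :
  class_Cn n f -> (i + j <= n)%nat -> continuity_2d_pt (partial_derive i j f) x y.
Proof.
intros f_Cn Hij. assert (H := ex_diff_n_deriv n i j Hij f x y (f_Cn x y)).
destruct (n - (i + j))%nat; apply H.
Qed.

(** The chain rule.  Differentiability of a partial derivative of order below
    [n] comes from continuity of its own partial derivatives; that its
    [y]-derivative is again a [partial_derive], although the [x]-derivatives
    are taken last there, is the symmetry of mixed derivatives. *)
Lemma partial_derive_line (n : nat) (f : R -> R -> R) (i j : nat)
    (x y a b t : R) :
  class_Cn n f -> (i + j < n)%nat ->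
  is_derive (fun s => partial_derive i j f (x + s * a) (y + s * b)) t
    (a * partial_derive (S i) j f (x + t * a) (y + t * b) +
     b * partial_derive i (S j) f (x + t * a) (y + t * b)).
Proof.
intros f_Cn Hij.
set (p := x + t * a). set (q := y + t * b).
assert (Hd : differentiable_pt_lim (partial_derive i j f) p q
   (partial_derive (S i) j f p q) (partial_derive i (S j) f p q)).
{ apply filterdiff_differentiable_pt_lim.
  apply (is_derive_filterdiff (partial_derive i j f) p q
           (partial_derive (S i) j f)).
  - apply filter_forall. intros [u v]. simpl fst. simpl snd.
    apply (Derive_correct (fun z => partial_derive i j f z v)).
    now apply (ex_diff_n_ex_deriv_inf_1 n).
  - rewrite <- Derive_partial_derive.
    + apply (Derive_correct (fun z => partial_derive i j f p z)).
      now apply (ex_diff_n_ex_deriv_inf_2 n).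
    + apply locally_2d_forall. intros u v.
      apply (ex_diff_n_m n); [lia|apply f_Cn].
  - apply (continuity_2d_pt_filterlim (partial_derive (S i) j f)).
    apply (partial_derive_continuous n); [exact f_Cn|lia]. }
apply is_derive_Reals.
replace (_ + _) with
  (partial_derive (S i) j f p q * a + partial_derive i (S j) f p q * b) by ring.
apply (derivable_pt_lim_comp_2d (partial_derive i j f)
  (fun s => x + s * a) (fun s => y + s * b)).
- exact Hd.
- apply is_derive_Reals. auto_derive; [trivial|ring].
- apply is_derive_Reals. auto_derive; [trivial|ring].
Qed.

(** The [k]-th derivative of [f] at [(x, y)] in the direction [(a, b)],
    expanded binomially so that it agrees term by term with the homogeneous
    part of degree [k] in [taylor_poly]. *)
Definition dir_derive (k : nat) (f : R -> R -> R) (a b x y : R) : R :=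
  sum_f_R0 (fun j => Binomial.C k j * a ^ (k - j) * b ^ j *
                     partial_derive (k - j) j f x y) k.

Lemma dir_derive_line (n : nat) (f : R -> R -> R) (k : nat)
    (x y a b t : R) :
  class_Cn n f -> (k < n)%nat ->
  is_derive (fun s => dir_derive k f a b (x + s * a) (y + s * b)) t
    (dir_derive (S k) f a b (x + t * a) (y + t * b)).
Proof.
intros f_Cn Hk.
set (p := x + t * a). set (q := y + t * b).
assert (E : dir_derive (S k) f a b p q =
  sum_f_R0 (fun j => Binomial.C k j * a ^ (k - j) * b ^ j *
    (a * partial_derive (S (k - j)) j f p q +
     b * partial_derive (k - j) (S j) f p q)) k).
{ unfold dir_derive.
  rewrite (sum_eq _ (fun j => Binomial.C (S k) j *
    (a ^ (S k - j) * b ^ j * partial_derive (S k - j) j f p q)))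
    by (intros; ring).
  rewrite pascal_sum. apply sum_eq. intros j Hj.
  rewrite Nat.sub_succ, Nat.sub_succ_l by lia. simpl pow. ring. }
rewrite E, <- sum_n_Reals. unfold dir_derive.
apply (is_derive_ext (fun s => sum_n (fun j =>
  Binomial.C k j * a ^ (k - j) * b ^ j *
  partial_derive (k - j) j f (x + s * a) (y + s * b)) k)).
{ intros s. apply sum_n_Reals. }
apply (is_derive_sum_n (fun j s => Binomial.C k j * a ^ (k - j) * b ^ j *
  partial_derive (k - j) j f (x + s * a) (y + s * b))).
intros j Hj. apply is_derive_scal. apply (partial_derive_line n); [exact f_Cn|lia].
Qed.

Lemma Derive_n_line (n : nat) (f : R -> R -> R) (k : nat)
    (x y a b t : R) :
  class_Cn n f -> (k <= n)%nat ->
  Derive_n (fun s => f (x + s * a) (y + s * b)) k t =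
  dir_derive k f a b (x + t * a) (y + t * b).
Proof.
intros f_Cn. revert t. induction k as [|k IH]; intros t Hk.
- unfold dir_derive, Binomial.C, partial_derive. simpl. field.
- simpl. rewrite (Derive_ext _ _ _ (fun s => IH s ltac:(lia))).
  apply is_derive_unique. now apply (dir_derive_line n).
Qed.

(** One-variable Taylor-Lagrange on [[0, 1]] for the restriction of [f] to the
    segment from [(x, y)] to [(x + a, y + b)]. *)
Lemma taylor_lagrange_line (n : nat) (f : R -> R -> R) (d : nat)
    (x y a b : R) :
  class_Cn n f -> (S d <= n)%nat ->
  exists t, 0 < t < 1 /\
    f (x + a) (y + b) = taylor_poly d f x y (x + a) (y + b) +
      / INR (fact (S d)) * dir_derive (S d) f a b (x + t * a) (y + t * b).
Proof.
intros f_Cn Hd.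
destruct (Taylor_Lagrange (fun s => f (x + s * a) (y + s * b)) d 0 1 Rlt_0_1)
  as [t [Ht E]].
{ intros t _ [|k] Hk; [exact I|].
  exists (dir_derive (S k) f a b (x + t * a) (y + t * b)).
  apply (is_derive_ext (fun s => dir_derive k f a b (x + s * a) (y + s * b))).
  - intros s. symmetry. apply (Derive_n_line n); [exact f_Cn|lia].
  - apply (dir_derive_line n); [exact f_Cn|lia]. }
exists t. split; [exact Ht|].
rewrite Rmult_1_l, Rmult_1_l in E. rewrite E. f_equal.
- unfold taylor_poly. apply sum_eq. intros k Hk.
  rewrite (Derive_n_line n) by (exact f_Cn || lia). rewrite Rmult_0_l, Rmult_0_l, !Rplus_0_r.
  rewrite Rminus_0_r, pow1.
  replace (x + a - x) with a by ring. replace (y + b - y) with b by ring.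
  unfold Rdiv, dir_derive. now rewrite Rmult_1_l.
- rewrite (Derive_n_line n) by (exact f_Cn || lia). rewrite Rminus_0_r, pow1.
  unfold Rdiv. now rewrite Rmult_1_l.
Qed.

(** * Uniform boundedness *)

Lemma continuous_Rabs_bounded (g : R -> R -> R) (B : box) :
  (forall x y, continuity_2d_pt g x y) ->
  exists K, forall x y, in_box B x y -> Rabs (g x y) <= K.
Proof.
intros Hc.
destruct (continuous_bounded g B Hc) as [K HK].
destruct (continuous_bounded (fun x y => - g x y) B) as [L HL].
{ intros x y. apply continuity_2d_pt_opp, Hc. }
exists (Rmax K L). intros x y Hxy. apply Rabs_le.
specialize (HK x y Hxy). specialize (HL x y Hxy).
pose proof (Rmax_l K L). pose proof (Rmax_r K L). lra.
Qed.

(** Stated over an arbitrary index type: the families of interest are indexed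
    by the squares inside [B0] for [taylor_S], and by the points of [B0] for
    the coefficients of the Taylor remainder. *)
Definition ubounded {T : Type} (P : T -> Prop) (g : T -> R) : Prop :=
  exists K, forall x, P x -> Rabs (g x) <= K.

Lemma ubounded_const {T} (P : T -> Prop) (c : R) : ubounded P (fun _ => c).
Proof. exists (Rabs c). intros x _. lra. Qed.

Lemma ubounded_plus {T} (P : T -> Prop) (g h : T -> R) :
  ubounded P g -> ubounded P h -> ubounded P (fun x => g x + h x).
Proof.
intros [K HK] [L HL]. exists (K + L). intros x Hx.
eapply Rle_trans; [apply Rabs_triang|].
specialize (HK x Hx). specialize (HL x Hx). lra.
Qed.

Lemma ubounded_mult {T} (P : T -> Prop) (g h : T -> R) :
  ubounded P g -> ubounded P h -> ubounded P (fun x => g x * h x).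
Proof.
intros [K HK] [L HL]. exists (K * L). intros x Hx. rewrite Rabs_mult.
apply Rmult_le_compat; auto using Rabs_pos.
Qed.

Lemma ubounded_pow {T} (P : T -> Prop) (g : T -> R) (k : nat) :
  ubounded P g -> ubounded P (fun x => g x ^ k).
Proof.
intros Hg. induction k as [|k IH]; simpl.
- apply ubounded_const.
- now apply ubounded_mult.
Qed.

Lemma ubounded_sum_f_R0 {T} (P : T -> Prop) (g : nat -> T -> R) (k : nat) :
  (forall j, (j <= k)%nat -> ubounded P (g j)) ->
  ubounded P (fun x => sum_f_R0 (fun j => g j x) k).
Proof.
induction k as [|k IH]; intros H; simpl.
- now apply H.
- apply ubounded_plus; [apply IH; intros; apply H; lia|now apply H].
Qed.

Lemma ubounded_sum_n_m {T} (P : T -> Prop) (g : nat -> T -> R) (m n : nat) :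
  (m <= n)%nat -> (forall k, (k <= n)%nat -> ubounded P (g k)) ->
  ubounded P (fun x => sum_n_m (fun k => g k x) m n).
Proof.
intros Hmn. induction Hmn as [|n Hmn IH]; intros H.
- destruct (H m (le_n _)) as [K HK]. exists K. intros x Hx.
  rewrite sum_n_n. now apply HK.
- destruct (ubounded_plus P _ _ (IH (fun k Hk => H k ltac:(lia)))
              (H (S n) (le_n _))) as [K HK].
  exists K. intros x Hx. rewrite sum_n_Sm by lia. now apply HK.
Qed.

(** * Squares inside a fixed box *)

Lemma mid_in_box (B : box) : in_box B (midx B) (midy B).
Proof.
pose proof (bx_le B). pose proof (by_le B).
unfold in_box, midx, midy. repeat split; lra.
Qed.

Lemma rad_ge0 (B : square) : 0 <= rad B.
Proof. pose proof (bx_le B). unfold rad, radx. lra. Qed.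

Lemma width_square (B : square) : width B = 2 * rad B.
Proof.
unfold width. rewrite <- (sq_rad B). unfold rad. now rewrite Rmax_left by lra.
Qed.

Lemma square_dist_mid (B : square) (x y : R) :
  in_box B x y -> Rabs (x - midx B) <= rad B /\ Rabs (y - midy B) <= rad B.
Proof.
intros [Hx Hy]. pose proof (sq_rad B) as E.
unfold rad, radx, rady, midx, midy in *. split; apply Rabs_le; lra.
Qed.

Lemma rad_ubounded (B0 : box) : ubounded (fun B : square => subbox B B0) rad.
Proof.
exists (radx B0). intros B HB. rewrite Rabs_pos_eq by apply rad_ge0.
pose proof (bx_le B) as Lx. pose proof (by_le B) as Ly.
destruct (HB (bax B) (bay B)) as [H1 _]; [unfold in_box; repeat split; lra|].
destruct (HB (bbx B) (bay B)) as [H2 _]; [unfold in_box; repeat split; lra|].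
unfold rad, radx. lra.
Qed.

Lemma taylor_S_ubounded (m n : nat) (f : R -> R -> R) (B0 : box)
    (bf : nat -> box -> itv) :
  (m <= n)%nat -> class_Cn n f ->
  (forall j, (j <= n)%nat -> bounded_over (bf j) B0) ->
  ubounded (fun B : square => subbox B B0) (taylor_S m n f bf).
Proof.
intros Hmn Hf Hbd. unfold taylor_S.
apply (ubounded_sum_n_m _ (fun k B => taylor_s n f bf B k * rad B ^ (k - m)));
  [exact Hmn|].
intros k Hk. apply ubounded_mult; [|apply ubounded_pow, rad_ubounded].
unfold taylor_s. apply ubounded_mult; [apply ubounded_const|].
apply (ubounded_sum_f_R0 _ (fun j (B : square) => Binomial.C k j *
  (if (k <? n)%nat
   then Rabs (partial_derive (k - j) j f (midx B) (midy B))
   else mag (bf j B)))).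
intros j Hj. apply ubounded_mult; [apply ubounded_const|].
destruct (k <? n)%nat.
- destruct (continuous_Rabs_bounded (partial_derive (k - j) j f) B0) as [K HK].
  { intros x y. apply (partial_derive_continuous n); [exact Hf|lia]. }
  exists K. intros B HB. rewrite Rabs_Rabsolu. apply HK, HB, mid_in_box.
- destruct (Hbd j ltac:(lia)) as [K HK]. exists K. intros B HB.
  rewrite Rabs_pos_eq; [now apply HK|].
  unfold mag. eapply Rle_trans; [apply Rabs_pos|apply Rmax_l].
Qed.

(** The bound must be uniform over all squares, hence its constant is a bound
    over the whole of [B0] for the sum of the derivatives of order [S d]; the
    intermediate point of the Lagrange remainder lies in [B], thus in [B0], by
    convexity. *)
Lemma taylor_remainder_bound (d n : nat) (f : R -> R -> R) (B0 : box) :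
  (S d <= n)%nat -> class_Cn n f ->
  exists K, forall B : square, subbox B B0 -> forall x y, in_box B x y ->
    Rabs (f x y - taylor_poly d f (midx B) (midy B) x y) <= K * rad B ^ S d.
Proof.
intros Hd Hf.
destruct (ubounded_sum_f_R0 (fun p : R * R => in_box B0 (fst p) (snd p))
  (fun j p => Binomial.C (S d) j *
     Rabs (partial_derive (S d - j) j f (fst p) (snd p))) (S d)) as [K HK].
{ intros j Hj. apply ubounded_mult; [apply ubounded_const|].
  destruct (continuous_Rabs_bounded (partial_derive (S d - j) j f) B0)
    as [K HK].
  { intros x y. apply (partial_derive_continuous n); [exact Hf|lia]. }
  exists K. intros p Hp. rewrite Rabs_Rabsolu. now apply HK. }
exists (/ INR (fact (S d)) * K). intros B HB x y Hxy.
set (a := x - midx B). set (b := y - midy B).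
destruct (square_dist_mid B x y Hxy) as [Ha Hb]. fold a in Ha. fold b in Hb.
destruct (taylor_lagrange_line n f d (midx B) (midy B) a b Hf Hd)
  as [t [Ht E]].
replace (midx B + a) with x in E by (unfold a; ring).
replace (midy B + b) with y in E by (unfold b; ring).
rewrite E. set (p := midx B + t * a). set (q := midy B + t * b).
assert (Hpq : in_box B p q).
{ destruct (mid_in_box B) as [M1 M2]. destruct Hxy as [H1 H2].
  unfold in_box, p, q, a, b. repeat split; nra. }
assert (Hr := rad_ge0 B).
assert (Hf0 : 0 < / INR (fact (S d)))
  by apply Rinv_0_lt_compat, INR_fact_lt_0.
replace (_ + _ - _) with (/ INR (fact (S d)) * dir_derive (S d) f a b p q)
  by ring.
rewrite Rabs_mult, (Rabs_pos_eq (/ _)) by lra. rewrite Rmult_assoc.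
apply Rmult_le_compat_l; [lra|].
specialize (HK (p, q) (HB p q Hpq)). simpl fst in HK. simpl snd in HK.
(* The power of the radius is distributed over the sum, to compare with the
   derivative in the direction (a, b) term by term. *)
apply Rle_trans with (2 := Rmult_le_compat_r _ _ _ (pow_le _ (S d) Hr) HK).
eapply Rle_trans;
  [|apply Rmult_le_compat_r; [apply pow_le, Hr|apply Rle_abs]].
rewrite (Rmult_comm _ (rad B ^ S d)), scal_sum.
eapply Rle_trans; [apply Rsum_abs|]. apply sum_Rle. intros j Hj.
assert (HC : 0 <= Binomial.C (S d) j).
{ unfold Binomial.C. pose proof (INR_fact_lt_0 (S d)).
  pose proof (INR_fact_lt_0 j). pose proof (INR_fact_lt_0 (S d - j)).
  apply Rlt_le, Rdiv_lt_0_compat; [|apply Rmult_lt_0_compat]; assumption. }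
rewrite !Rabs_mult, (Rabs_pos_eq (Binomial.C _ _)) by exact HC.
rewrite <- !RPow_abs.
replace (rad B ^ S d) with (rad B ^ (S d - j) * rad B ^ j)
  by (rewrite <- pow_add; f_equal; lia).
rewrite !Rmult_assoc. apply Rmult_le_compat_l; [exact HC|].
rewrite (Rmult_comm (Rabs (partial_derive _ _ _ _ _))), <- !Rmult_assoc.
apply Rmult_le_compat_r; [apply Rabs_pos|].
apply Rmult_le_compat; try (apply pow_le, Rabs_pos);
  apply pow_incr; split; auto using Rabs_pos.
Qed.

(** * Stability of ranges in the Hausdorff distance *)

Lemma range_extrema (g : R -> R -> R) (B : box) :
  (forall x y, continuity_2d_pt g x y) ->
  (image g B (lo (range g B)) /\ image g B (hi (range g B))) /\
  forall x y, in_box B x y -> lo (range g B) <= g x y <= hi (range g B).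
Proof.
intros Hc. assert (H := range_exact g B Hc).
assert (Hin : forall x y, in_box B x y ->
                lo (range g B) <= g x y <= hi (range g B)).
{ intros x y Hxy. apply (H (g x y)). now exists x, y. }
split; [|exact Hin].
(* The value at the midpoint shows that the endpoints are in order, so that
   each of them belongs to the interval and is therefore attained. *)
specialize (Hin _ _ (mid_in_box B)).
split; apply H; unfold in_itv; lra.
Qed.

(** Each endpoint of either range is a value attained at some point of [B], and
    the other function is within [e] of it at that same point. *)
Lemma dH_range_le (g h : R -> R -> R) (B : box) (e : R) :
  (forall x y, continuity_2d_pt g x y) ->
  (forall x y, continuity_2d_pt h x y) ->
  (forall x y, in_box B x y -> Rabs (g x y - h x y) <= e) ->
  dH (range g B) (range h B) <= e.
Proof.
intros Hg Hh He.
destruct (range_extrema g B Hg)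
  as [[[x1 [y1 [B1 E1]]] [x2 [y2 [B2 E2]]]] Ig].
destruct (range_extrema h B Hh)
  as [[[x3 [y3 [B3 E3]]] [x4 [y4 [B4 E4]]]] Ih].
unfold dH. apply Rmax_lub; apply Rabs_le.
- pose proof (Ig _ _ B3). pose proof (Ih _ _ B1).
  pose proof (proj1 (Rabs_le_between _ _) (He _ _ B1)).
  pose proof (proj1 (Rabs_le_between _ _) (He _ _ B3)). lra.
- pose proof (Ig _ _ B4). pose proof (Ih _ _ B2).
  pose proof (proj1 (Rabs_le_between _ _) (He _ _ B2)).
  pose proof (proj1 (Rabs_le_between _ _) (He _ _ B4)). lra.
Qed.

Lemma dH_iadd_ball0 (I J : itv) (rho : R) :
  dH I (iadd J (ball0 rho)) <= dH I J + Rabs rho.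
Proof.
unfold dH, iadd, ball0. simpl.
pose proof (Rmax_l (Rabs (lo I - lo J)) (Rabs (hi I - hi J))).
pose proof (Rmax_r (Rabs (lo I - lo J)) (Rabs (hi I - hi J))).
apply Rmax_lub.
- replace (_ - (_ + _)) with ((lo I - lo J) + rho) by ring.
  eapply Rle_trans; [apply Rabs_triang|]. lra.
- replace (_ - (_ + _)) with ((hi I - hi J) + - rho) by ring.
  eapply Rle_trans; [apply Rabs_triang|]. rewrite Rabs_Ropp. lra.
Qed.

Theorem theorem3 (m n : nat) (hm : (1 <= m)%nat) (hmn : (m <= n)%nat)
    (f : R -> R -> R) (hf : class_Cn n f) (B0 : box)
    (bf : nat -> box -> itv)
    (hbf : forall j : nat, (j <= n)%nat ->
             range_function (partial_derive (n - j) j f) (bf j))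
    (hbd : forall j : nat, (j <= n)%nat -> bounded_over (bf j) B0) :
  convergence_of_order m f (taylor_form m n f bf) B0.
Proof.
destruct m as [|d]; [lia|].
destruct (taylor_remainder_bound d n f B0 hmn hf) as [K HK].
destruct (taylor_S_ubounded (S d) n f B0 bf hmn hf hbd) as [L HL].
(* The summand 1 makes the constant positive even when both bounds vanish. *)
exists (Rabs K + Rabs L + 1). split.
{ pose proof (Rabs_pos K). pose proof (Rabs_pos L). lra. }
intros B HB. specialize (HK B HB). specialize (HL B HB).
assert (Hr := rad_ge0 B). assert (Hp := pow_le _ (S d) Hr).
assert (Hw : rad B ^ S d <= width B ^ S d).
{ apply pow_incr. rewrite width_square. lra. }
unfold taylor_form. replace (S d - 1)%nat with d by lia.
eapply Rle_trans; [apply dH_iadd_ball0|].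
assert (HT : dH (range f B) (range (taylor_poly d f (midx B) (midy B)) B)
             <= K * rad B ^ S d).
{ apply dH_range_le.
  - apply (fun x y => partial_derive_continuous n f 0 0 x y hf ltac:(lia)).
  - intros x y. apply taylor_poly_continuous.
  - exact HK. }
rewrite Rabs_mult, (Rabs_pos_eq _ Hp).
pose proof (Rle_abs K). pose proof (Rle_abs L).
pose proof (Rabs_pos K). pose proof (Rabs_pos L).
apply Rle_trans with ((Rabs K + Rabs L) * rad B ^ S d).
- nra.
- apply Rmult_le_compat; lra.
Qed.
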